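(* Let $\mathbf{c}, \mathbf{s}_1, \mathbf{s}_2, \mathbf{s}_3 \in \mathbb{R}^3$ be points such that $\mathbf{s}_1, \mathbf{s}_2, \mathbf{s}_3$ are not collinear, and let $r, t_1, t_2, t_3 \in \mathbb{R}$ be numbers with $r \ge 0$. Consider the set $$\mathcal{S} := \bigl\{(\mathbf{x},t) \in \mathbb{R}^3 \times \mathbb{R} \mid \lVert \mathbf{x} - \mathbf{c}\rVert = r \ \text{and} \ \lVert \mathbf{x} - \mathbf{s}_i\rVert = |t_i - t| \ \text{for} \ i = 1, 2, 3\bigr\}.$$ Then there is a polynomial $f$ (in one variable, with real coefficients) of degree four such that every $(\mathbf{x},t) \in \mathcal{S}$ satisfies $f(t) = 0$. Moreover, one can take $f(t) := \det(C)$, where, with $d_i := \lVert \mathbf{s}_i - \mathbf{c}\rVert$ and $d_{i,j} := \lVert \mathbf{s}_i - \mathbf{s}_j\rVert$, $$C = \begin{pmatrix} 0 & 1 & 1 & 1 & 1 & 1 \\ 1 & 0 & r^2 & (t_1 - t)^2 & (t_2 - t)^2 & (t_3 - t)^2 \\ 1 & r^2 & 0 & d_1^2 & d_2^2 & d_3^2 \\ 1 & (t_1 - t)^2 & d_1^2 & 0 & d_{1,2}^2 & d_{1,3}^2 \\ 1 & (t_2 - t)^2 & d_2^2 & d_{2,1}^2 & 0 & d_{2,3}^2 \\ 1 & (t_3 - t)^2 & d_3^2 & d_{3,1}^2 & d_{3,2}^2 & 0 \end{pmatrix}.$$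
   Context: $\|\cdot\|$ denotes the Euclidean norm on $\mathbb{R}^3$. The set $\mathcal{S}$ is the set of solutions of the global positioning problem (with $|t_i - t|$ in place of $t_i - t$) for three satellites at positions $\mathbf{s}_i$ with measured time differences $t_i$, unknown user position $\mathbf{x}$ and unknown clock offset $t$, with the user restricted to the sphere with center $\mathbf{c}$ and radius $r$. *)

(* Defs.v *)
From mathcomp Require Import all_boot all_order all_algebra.
From mathcomp Require Import classical_sets reals.

Set Implicit Arguments.
Unset Strict Implicit.
Unset Printing Implicit Defensive.

Import Order.TTheory GRing.Theory Num.Theory.

Local Open Scope classical_set_scope.
Local Open Scope ring_scope.

(* The norm that MathComp-Analysis puts on row vectors is the sup norm, hence
   this separate definition. *)
Definition enorm (R : realType) (n : nat) (x : 'rV[R]_n) : R :=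
  Num.sqrt (\sum_(i < n) x 0 i ^+ 2).

Definition line (R : realType) (n : nat) (p v : 'rV[R]_n) : set 'rV[R]_n :=
  [set p + k *: v | k in [set: R]].

Definition collinear (R : realType) (n : nat) (a b c : 'rV[R]_n) : Prop :=
  exists p v : 'rV[R]_n,
    v != 0 /\ [/\ line p v a, line p v b & line p v c].

Definition gps_solutions (R : realType) (c s1 s2 s3 : 'rV[R]_3)
    (r t1 t2 t3 : R) : set ('rV[R]_3 * R) :=
  [set xt | [/\ enorm (xt.1 - c) = r,
                enorm (xt.1 - s1) = `|t1 - xt.2|,
                enorm (xt.1 - s2) = `|t2 - xt.2| &
                enorm (xt.1 - s3) = `|t3 - xt.2|]].

Definition mx_of_rows (A : pzRingType) (m n : nat) (rows : seq (seq A)) :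
    'M[A]_(m, n) :=
  \matrix_(i < m, j < n) nth 0 (nth [::] rows i) j.

(* The clock offset t is the indeterminate 'X, so the determinant of this
   matrix is a polynomial in t. *)
Definition gps_mx (R : realType) (c s1 s2 s3 : 'rV[R]_3)
    (r t1 t2 t3 : R) : 'M[{poly R}]_6 :=
  let dist2 (a b : 'rV[R]_3) : {poly R} := (enorm (a - b) ^+ 2)%:P in
  let r2 : {poly R} := (r ^+ 2)%:P in
  let T (ti : R) : {poly R} := (ti%:P - 'X) ^+ 2 in
  mx_of_rows 6 6
    [:: [:: 0; 1;    1;          1;           1;           1          ];
        [:: 1; 0;    r2;         T t1;        T t2;        T t3       ];
        [:: 1; r2;   0;          dist2 s1 c;  dist2 s2 c;  dist2 s3 c ];
        [:: 1; T t1; dist2 s1 c; 0;           dist2 s1 s2; dist2 s1 s3];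
        [:: 1; T t2; dist2 s2 c; dist2 s2 s1; 0;           dist2 s2 s3];
        [:: 1; T t3; dist2 s3 c; dist2 s3 s1; dist2 s3 s2; 0          ]].

(* Main.v *)
Require Import Defs.
From mathcomp Require Import all_boot all_order all_algebra perm.
From mathcomp Require Import classical_sets reals.
From mathcomp Require Import ring zify.
Set Implicit Arguments.
Unset Strict Implicit.
Unset Printing Implicit Defensive.

Import Order.TTheory GRing.Theory Num.Theory.
Local Open Scope ring_scope.

(** At a solution (x, t) the entries of [gps_mx] become squared distances
    between the five points x, c, s1, s2, s3, so the matrix becomes a
    Cayley-Menger matrix.  Since |p - q|^2 = |p|^2 + |q|^2 - 2 p.q, such a matrix
    for points of R^n is the product of two matrices with inner dimension n + 2;
    for more than n + 1 points it is therefore singular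
    ([det_cayley_menger]), and t is a root of f = det C.

    For the degree, give weight 2 to the row and to the column that hold the
    (t_i - t)^2, and weight 0 to the others.  Every entry has degree at most the
    weight of its row plus that of its column, so by the Leibniz formula f has
    degree at most 2 + 2, and its coefficient in degree 4 is the determinant of
    the matrix of the corresponding leading coefficients ([det_top]).  That
    matrix no longer contains r and the t_i, and its determinant is Heron's
    expression in the sides of the triangle s1 s2 s3, that is, 16 times its
    squared area, or 4 (|u|^2 |v|^2 - (u.v)^2) with u = s2 - s1 and
    v = s3 - s1.  By the equality case of Cauchy-Schwarz it vanishes only for
    collinear points ([collinear_of_gram]), so f has degree exactly 4. *)

(** * Leading coefficients of products and determinants *)

Lemma coefM_top (A : nzSemiRingType) (p q : {poly A}) m n :
  (size p <= m.+1)%N -> (size q <= n.+1)%N -> (p * q)`_(m + n) = p`_m * q`_n.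
Proof.
move=> le_p le_q.
rewrite coefM (bigD1 (inord m)) //= inordK ?ltnS ?leq_addr // addKn.
rewrite big1 ?addr0 // => i; rewrite -val_eqE /= inordK ?ltnS ?leq_addr // => ne_im.
have [lt_im|lt_mi|eq_im] := ltngtP i m; last by rewrite eq_im eqxx in ne_im.
  rewrite [q`__]nth_default ?mulr0 // (leq_trans le_q) //.
  by rewrite ltn_subRL ltn_add2r.
by rewrite nth_default ?mul0r // (leq_trans le_p).
Qed.

Lemma coef_prod_top (A : comNzSemiRingType) (I : Type) (s : seq I)
    (F : I -> {poly A}) (d : I -> nat) :
    (forall i, size (F i) <= (d i).+1)%N ->
  (size (\prod_(i <- s) F i)%R <= (\sum_(i <- s) d i).+1)%N /\
  (\prod_(i <- s) F i)`_(\sum_(i <- s) d i) = \prod_(i <- s) (F i)`_(d i).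
Proof.
move=> le_F; elim: s => [|i s [IHs IHc]]; first by rewrite !big_nil size_poly1 coef1.
rewrite !big_cons coefM_top // IHc; split=> //.
have := size_polyMleq (F i) (\prod_(i <- s) F i); have := le_F i; lia.
Qed.

(** In each term of the Leibniz formula a permutation picks every row and every
    column once, so all the terms have the same degree bound [d]. *)
Lemma det_top (A : comNzRingType) n (M : 'M[{poly A}]_n) (w v : 'I_n -> nat) :
    (forall i j, size (M i j) <= (w i + v j).+1)%N ->
  let d := (\sum_i w i + \sum_j v j)%N in
  (size (\det M) <= d.+1)%N /\
  (\det M)`_d = \det (\matrix_(i, j) (M i j)`_(w i + v j)).
Proof.
move=> le_M d.
have sumE (s : 'S_n) : (\sum_i (w i + v (s i)))%N = d.
  by rewrite big_split; congr addn; rewrite [RHS](reindex_inj (@perm_inj _ s)).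
have top (s : 'S_n) := coef_prod_top (index_enum 'I_n) (fun i => le_M i (s i)).
split.
  apply/leq_sizeP => k lt_dk; rewrite coef_sum big1 // => s _.
  have [le_s _] := top s; rewrite sumE in le_s.
  rewrite -signr_odd mulr_sign.
  by case: ifP => _; rewrite ?coefN nth_default ?oppr0 // (leq_trans le_s).
rewrite coef_sum; apply: eq_bigr => s _; have [_] := top s; rewrite sumE => eq_s.
under [in RHS]eq_bigr do rewrite mxE.
rewrite -eq_s; case: (odd_perm s); last by rewrite !expr0 !mul1r.
by rewrite !expr1 !mulN1r coefN.
Qed.

Lemma size_sqr_lin (R : nzRingType) (a : R) : (size ((a%:P - 'X) ^+ 2)%R <= 3)%N.
Proof.
by rewrite -sqrrN opprB (leq_trans (size_poly_exp_leq _ _)) // size_XsubC.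
Qed.

Lemma coef_sqr_lin (R : nzRingType) (a : R) : ((a%:P - 'X) ^+ 2)`_2 = 1.
Proof.
rewrite -sqrrN opprB; have /monicP := monic_exp 2 (monicXsubC a).
by rewrite lead_coefE size_exp_XsubC.
Qed.

(** * Euclidean norm and collinearity *)

Lemma enorm_sq (R : realType) n (x : 'rV[R]_n) : enorm x ^+ 2 = (x *m x^T) 0 0.
Proof.
rewrite /enorm sqr_sqrtr ?sumr_ge0 // => [|i _]; last exact: sqr_ge0.
by rewrite mxE; apply: eq_bigr => i _; rewrite mxE.
Qed.

Lemma enorm_subZ (R : realType) n (k : R) (x y : 'rV[R]_n) :
  enorm (x - k *: y) ^+ 2 =
  enorm x ^+ 2 - 2 * k * (x *m y^T) 0 0 + k ^+ 2 * enorm y ^+ 2.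
Proof.
rewrite !enorm_sq !mxE !mulr_sumr -sumrB -big_split.
by apply: eq_bigr => i _; rewrite !mxE /=; ring.
Qed.

Lemma enormB (R : realType) n (x y : 'rV[R]_n) : enorm (x - y) = enorm (y - x).
Proof.
rewrite /enorm; under eq_bigr do rewrite !mxE -sqrrN opprB.
by under [in RHS]eq_bigr do rewrite !mxE.
Qed.

Lemma enorm_eq0 (R : realType) n (x : 'rV[R]_n) : enorm x ^+ 2 = 0 -> x = 0.
Proof.
rewrite /enorm sqr_sqrtr ?sumr_ge0 // => [|i _]; last exact: sqr_ge0.
move/eqP; rewrite psumr_eq0 => [/allP x0|i _]; last exact: sqr_ge0.
apply/rowP => i; rewrite mxE; apply/eqP; rewrite -sqrf_eq0.
exact: x0 (mem_index_enum i).
Qed.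

(** Equality in Cauchy-Schwarz: if u is not 0, then v - k u = 0 for the
    coefficient k of the orthogonal projection of v on u.  The hypothesis on [n]
    provides a direction for the line when the three points coincide. *)
Lemma collinear_of_gram (R : realType) n (a b c : 'rV[R]_n) : (0 < n)%N ->
  let u := b - a in let v := c - a in
  enorm u ^+ 2 * enorm v ^+ 2 = ((u *m v^T) 0 0) ^+ 2 -> collinear a b c.
Proof.
move=> n_gt0 u v gram0.
have on_line p w : line p w p by exists 0 => //; rewrite scale0r addr0.
have [u0|u_neq0] := eqVneq u 0.
  have <- : a = b by apply/eqP; rewrite eq_sym -subr_eq0 -/u u0.
  have [v0|v_neq0] := eqVneq v 0.
    have <- : a = c by apply/eqP; rewrite eq_sym -subr_eq0 -/v v0.
    exists a, (const_mx 1); split; last by split; apply: on_line.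
    apply/rV0Pn; exists (Ordinal n_gt0); rewrite mxE oner_neq0 //.
  exists a, v; split=> //; split; [exact: on_line|exact: on_line|].
  by exists 1 => //; rewrite scale1r addrC subrK.
have U0 : enorm u ^+ 2 != 0 by apply: contra_neq u_neq0 => /enorm_eq0.
pose k := (u *m v^T) 0 0 / enorm u ^+ 2.
have v_ku : v - k *: u = 0.
  apply: enorm_eq0; rewrite enorm_subZ.
  have -> : (v *m u^T) 0 0 = (u *m v^T) 0 0.
    by rewrite -{1}(trmxK v) -trmx_mul mxE.
  have -> : enorm v ^+ 2 = ((u *m v^T) 0 0) ^+ 2 / enorm u ^+ 2.
    by rewrite -gram0 mulrAC divff // mul1r.
  by rewrite /k; move: U0; rewrite sqrf_eq0 => U0; field.
exists a, u; split=> //; split; first exact: on_line.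
  by exists 1 => //; rewrite scale1r addrC subrK.
by exists k => //; rewrite -(subr0_eq v_ku) addrC subrK.
Qed.

(** * Laplace expansion of a matrix given by its list of rows *)

Definition delete_nth {T : Type} (j : nat) (s : seq T) : seq T :=
  take j s ++ drop j.+1 s.

Lemma nth_delete_nth {T : Type} (x0 : T) j s k :
  nth x0 (delete_nth j s) k = nth x0 s (bump j k).
Proof.
rewrite nth_cat size_take_min /bump; case: (ltnP k (minn j (size s))) => [|le_k].
  by rewrite leq_min => /andP[lt_kj _]; rewrite nth_take // leqNgt lt_kj.
rewrite nth_drop; case: (leqP j (size s)) => [le_j|lt_j].
  move/minn_idPl: (le_j) le_k => -> le_k; rewrite le_k add1n.
  by congr nth; rewrite addSn subnKC.
move/ltnW/minn_idPr: (lt_j) le_k => -> le_k.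
rewrite !nth_default //; first exact: leq_trans le_k (leq_addl _ _).
by rewrite addSn (leq_trans (ltnW lt_j)) // -addSn leqW ?leq_addr.
Qed.

(** Unlike the expansion along a row of an abstract matrix, this form computes:
    for a concrete list of rows, the minors are again concrete lists. *)
Lemma det_mx_of_rows (A : comPzRingType) n (r0 : seq A) rows :
  \det (mx_of_rows n.+1 n.+1 (r0 :: rows)) =
  \sum_(0 <= j < n.+1)
    r0`_j * ((-1) ^+ j * \det (mx_of_rows n n (map (delete_nth j) rows))).
Proof.
rewrite (expand_det_row _ ord0) big_mkord; apply: eq_bigr => j _.
rewrite mxE /cofactor add0n; congr (_ * (_ * \det _)).
apply/matrixP => i k; rewrite !mxE /= -(nth_delete_nth 0 j); congr (_`_k).
have [lt_i|le_i] := ltnP i (size rows); first by rewrite (nth_map [::]).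
by rewrite !nth_default ?size_map.
Qed.

(** * The degree of the determinant *)

(** Heron's formula in disguise.  The first two rows and columns differ only at
    one entry, so clearing with it removes the d_i and leaves, up to sign, the
    Cayley-Menger determinant of a triangle with squared sides a, b, c. *)
Lemma det_gps_lead (R : comPzRingType) (a b c d1 d2 d3 : R) :
  \det (mx_of_rows 6 6
    [:: [:: 0; 0; 1;  1;  1;  1 ];
        [:: 0; 0; 0;  1;  1;  1 ];
        [:: 1; 0; 0;  d1; d2; d3];
        [:: 1; 1; d1; 0;  a;  b ];
        [:: 1; 1; d2; a;  0;  c ];
        [:: 1; 1; d3; b;  c;  0 ]]) =
  2 * (a * b + a * c + b * c) - (a ^+ 2 + b ^+ 2 + c ^+ 2).
Proof.
(* Unlocking turns a sum over a concrete range into an explicit sum; dropping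
   the zero terms at each step keeps the number of minors small. *)
do 6 rewrite !det_mx_of_rows unlock /= ?(mul0r, add0r).
by rewrite !det_mx00; ring.
Qed.

Lemma det_gps_mx_top (R : realType) (c s1 s2 s3 : 'rV[R]_3) (r t1 t2 t3 : R) :
  let f := \det (gps_mx c s1 s2 s3 r t1 t2 t3) in
  (size f <= 5)%N /\
  f`_4 = 4 * (enorm (s2 - s1) ^+ 2 * enorm (s3 - s1) ^+ 2
              - (((s2 - s1) *m (s3 - s1)^T) 0 0) ^+ 2).
Proof.
move=> f.
(* Index 1 is the row and the column of the unknown point, which hold the
   squares of t_i - t. *)
pose w (i : 'I_6) := (2 * (val i == 1))%N.
have le_w i j : (size (gps_mx c s1 s2 s3 r t1 t2 t3 i j) <= (w i + w j).+1)%N.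
  rewrite mxE.
  case: i => [[|[|[|[|[|[|//]]]]]] lt_i]; case: j => [[|[|[|[|[|[|//]]]]]] lt_j];
    rewrite /w /= ?size_poly0 ?size_poly1 ?size_sqr_lin //
      (leq_trans (size_polyC_leq1 _)) //.
have [] := det_top le_w.
have -> : (\sum_i w i + \sum_j w j = 4)%N by rewrite !big_ord_recl !big_ord0.
move=> le_f ->; split=> //.
rewrite (_ : \matrix_(i, j) _ = mx_of_rows 6 6
 [:: [:: 0; 0; 1; 1; 1; 1];
  [:: 0; 0; 0; 1; 1; 1];
  [:: 1; 0; 0; enorm (s1 - c) ^+ 2; enorm (s2 - c) ^+ 2; enorm (s3 - c) ^+ 2];
  [:: 1; 1; enorm (s1 - c) ^+ 2; 0; enorm (s1 - s2) ^+ 2; enorm (s1 - s3) ^+ 2];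
  [:: 1; 1; enorm (s2 - c) ^+ 2; enorm (s1 - s2) ^+ 2; 0; enorm (s2 - s3) ^+ 2];
  [:: 1; 1; enorm (s3 - c) ^+ 2; enorm (s1 - s3) ^+ 2; enorm (s2 - s3) ^+ 2; 0]]); last first.
  apply/matrixP; case=> [[|[|[|[|[|[|//]]]]]] lt_i];
    case=> [[|[|[|[|[|[|//]]]]]] lt_j];
    by rewrite !mxE /w /= ?coef0 ?coef1 ?coefC ?coef_sqr_lin //= enormB.
rewrite det_gps_lead.
(* The third side of the triangle, by the law of cosines. *)
have -> : enorm (s2 - s3) ^+ 2 = enorm ((s2 - s1) - 1 *: (s3 - s1)) ^+ 2.
  by rewrite scale1r opprB addrA subrK.
rewrite enorm_subZ (enormB s1 s2) (enormB s1 s3).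
ring.
Qed.

(** * Vanishing at the solutions *)

Definition cayley_menger (R : realType) (m n : nat) (P : 'M[R]_(m, n)) :
    'M[R]_(1 + m) :=
  block_mx 0 (const_mx 1)
    (const_mx 1) (\matrix_(i, j) enorm (row i P - row j P) ^+ 2).

(** [L] and [L'] are the two factors of the Cayley-Menger matrix; the entry
    |p_i - p_j|^2 is (|p_i|^2, 1, p_i) times (1, |p_j|^2, -2 p_j). *)
Lemma det_cayley_menger (R : realType) m n (P : 'M[R]_(m, n)) :
  (n.+1 < m)%N -> \det (cayley_menger P) = 0.
Proof.
move=> lt_nm.
pose N : 'cV[R]_m := \col_i enorm (row i P) ^+ 2.
pose L : 'M_(1 + m, 1 + (1 + n)) :=
  block_mx 1 0 N (row_mx (const_mx 1) P).
pose L' : 'M_(1 + (1 + n), 1 + m) :=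
  block_mx 0 (const_mx 1) (col_mx 1 0) (col_mx N^T (- 2 *: P^T)).
have -> : cayley_menger P = L *m L'.
  rewrite mulmx_block !mul_row_col !mul1mx !mul0mx !mulmx0 !mulmx1 !add0r !addr0.
  congr block_mx; apply/matrixP => i j.
  rewrite [LHS]mxE -[X in _ - X]scale1r enorm_subZ.
  rewrite !(mxE, big_ord1) /=.
  have -> : \sum_(l < n) P i l * (- 2 *: P^T) l j =
            - 2 * \sum_(l < n) row i P 0 l * (row j P)^T l 0.
    by rewrite mulr_sumr; apply: eq_bigr => l _; rewrite !mxE; ring.
  by ring.
apply: contraTeq lt_nm => det_neq0; rewrite -leqNgt.
have /eqP rank_full : row_free (L *m L') by rewrite row_free_unit unitmxE unitfE.
have := mulmx_max_rank L L'; rewrite rank_full.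
by rewrite !add1n ltnS.
Qed.

Lemma gps_solution_root (R : realType) (c s1 s2 s3 : 'rV[R]_3)
    (r t1 t2 t3 : R) (x : 'rV[R]_3) (t : R) :
  gps_solutions c s1 s2 s3 r t1 t2 t3 (x, t) ->
  (\det (gps_mx c s1 s2 s3 r t1 t2 t3)).[t] = 0.
Proof.
case=> /= xc x1 x2 x3.
pose P : 'M[R]_(5, 3) := \matrix_i nth 0 [:: x; c; s1; s2; s3] i.
rewrite -horner_evalE -det_map_mx -(@det_cayley_menger R 5 3 P) //; congr (\det _).
have sq_abs a b : enorm (x - a) = `|b - t| -> enorm (x - a) ^+ 2 = (b - t) ^+ 2.
  by move=> ->; rewrite real_normK ?num_real.
have dist0 a : enorm (a - a :> 'rV[R]_3) ^+ 2 = 0.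
  by rewrite subrr enorm_sq mul0mx mxE.
apply/matrixP => i j; rewrite [LHS]mxE [LHS]/= horner_evalE.
rewrite [X in X.[_]]mxE /cayley_menger.
case: (split_ordP (m := 1) (n := 5) i) => {}i ->;
case: (split_ordP (m := 1) (n := 5) j) => {}j ->;
  rewrite (@block_mxEul _ 1 5 1 5, @block_mxEur _ 1 5 1 5,
           @block_mxEdl _ 1 5 1 5, @block_mxEdr _ 1 5 1 5) [RHS]mxE /=.
- by rewrite !ord1 /= horner0.
- by rewrite ord1; case: j => [[|[|[|[|[|//]]]]] lt_j]; rewrite /= hornerE.
- by rewrite ord1; case: i => [[|[|[|[|[|//]]]]] lt_i]; rewrite /= hornerE.
rewrite !rowK.
case: i => [[|[|[|[|[|//]]]]] lt_i]; case: j => [[|[|[|[|[|//]]]]] lt_j] /=;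
 rewrite ?hornerE ?dist0 // ?[enorm (_ - x)]enormB
   ?(sq_abs _ _ x1) ?(sq_abs _ _ x2) ?(sq_abs _ _ x3) ?xc //;
  by rewrite enormB.
Qed.

Theorem theorem2 (R : realType) (c s1 s2 s3 : 'rV[R]_3) (r t1 t2 t3 : R)
    (s_ncol : ~ collinear s1 s2 s3) (r_ge0 : 0 <= r) :
  (exists f : {poly R},
     size f = 5%N /\
     forall (x : 'rV[R]_3) (t : R),
       gps_solutions c s1 s2 s3 r t1 t2 t3 (x, t) -> f.[t] = 0) /\
  (let f : {poly R} := \det (gps_mx c s1 s2 s3 r t1 t2 t3) in
     size f = 5%N /\
     forall (x : 'rV[R]_3) (t : R),
       gps_solutions c s1 s2 s3 r t1 t2 t3 (x, t) -> f.[t] = 0).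
Proof.
pose f := \det (gps_mx c s1 s2 s3 r t1 t2 t3).
suff size_f : size f = 5%N.
  have root_f x t := @gps_solution_root R c s1 s2 s3 r t1 t2 t3 x t.
  by split; [exists f|].
have [le_f f4] := det_gps_mx_top c s1 s2 s3 r t1 t2 t3.
apply/eqP; rewrite eqn_leq le_f ltnNge; apply/negP => /leq_sizeP /(_ 4%N (leqnn _)).
rewrite f4 => /eqP; rewrite mulf_eq0 pnatr_eq0 /= subr_eq0 => /eqP gram0.
exact/s_ncol/collinear_of_gram.
Qed.
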